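(* (1) Let $n$ be a positive integer. For almost all two-player $n\times n$ normal form games $(A,B)$ (i.e. for almost every pair $(A,B)\in\mathbb{R}^{n\times n}\times\mathbb{R}^{n\times n}$ with respect to Lebesgue measure) there exists a unique point $(\bar{\mathbf{x}},\bar{\mathbf{y}})\in\{(\mathbf{x},\mathbf{y})\in\mathbb{R}^{2n}:\sum_{i=1}^n x_i=1,\ \sum_{i=1}^n y_i=1\}$ such that $$\mathbf{x}^TA\bar{\mathbf{y}}=(\mathbf{x}')^TA\bar{\mathbf{y}}\quad\forall\,\mathbf{x},\mathbf{x}'\in\Delta_A,\qquad \bar{\mathbf{x}}^TB\mathbf{y}=\bar{\mathbf{x}}^TB\mathbf{y}'\quad\forall\,\mathbf{y},\mathbf{y}'\in\Delta_B.$$ (2) Moreover, let $(A,B)$ be a nondegenerate $3\times 3$ game all of whose best response regions have positive measure. If the point $(\bar{\mathbf{x}},\bar{\mathbf{y}})$ does not exist, the indifferent lines are parallel to each other; that is, if no $\bar{\mathbf{y}}$ with the first property exists, then the (nonempty) indifferent lines $l^A_{12},l^A_{13},l^A_{23}$ are parallel to each other, and if no $\bar{\mathbf{x}}$ with the second property exists, then the (nonempty) indifferent lines $l^B_{12},l^B_{13},l^B_{23}$ are parallel to each other.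
   Context: In an $n\times n$ game $(A,B)$, $A$ and $B$ are real $n\times n$ payoff matrices of Players A and B, and $\Delta_A=\Delta_B=\{\mathbf{z}\in\mathbb{R}^n: z_i\ge0,\ \sum_i z_i=1\}$ are the sets of mixed strategies; the utilities at $(\mathbf{x},\mathbf{y})$ are $\mathbf{x}^TA\mathbf{y}$ and $\mathbf{x}^TB\mathbf{y}$. For $3\times3$ games, the best response regions are $Z^A_i=\{\mathbf{y}\in\Delta_B:(A\mathbf{y})_i\ge(A\mathbf{y})_k\ \forall k\}$ and $Z^B_j=\{\mathbf{x}\in\Delta_A:(\mathbf{x}^TB)_j\ge(\mathbf{x}^TB)_k\ \forall k\}$ (measure: two-dimensional Lebesgue measure on the simplex). The game is nondegenerate if against every pure strategy of each player the opponent has a unique pure best response. The indifferent lines are, for $\{i,j,k\}=\{1,2,3\}$, $$l^A_{jk}=\{\mathbf{y}\in\Delta_B:(A\mathbf{y})_j=(A\mathbf{y})_k>(A\mathbf{y})_i\},\qquad l^B_{jk}=\{\mathbf{x}\in\Delta_A:(\mathbf{x}^TB)_j=(\mathbf{x}^TB)_k>(\mathbf{x}^TB)_i\}.$$ Parallel means that they lie on parallel straight lines of the plane $\{\mathbf{z}\in\mathbb{R}^3:\sum_i z_i=1\}$. *)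

(* Defs.v *)
From HB Require Import structures.
From mathcomp Require Import all_boot all_order all_algebra.
From mathcomp Require Import all_classical all_reals all_analysis.

Set Implicit Arguments.
Unset Strict Implicit.
Unset Printing Implicit Defensive.
Import Order.TTheory GRing.Theory Num.Theory.
Local Open Scope classical_set_scope.
Local Open Scope ring_scope.

Definition cons_pair (T : Type) (n : nat) (p : T * n.-tuple T) :
  n.+1.-tuple T := [tuple of p.1 :: p.2].

Section push_cons.
Context (R : realType) (n : nat).
Local Notation T := (measurableTypeR R).
Variable mu : {sigma_finite_measure set (n.-tuple T) -> \bar R}.

Definition push_cons : set (n.+1.-tuple T) -> \bar R :=
  pushforward (@lebesgue_measure R \x mu)%E (@cons_pair T n).

Let measurable_cons_pair : measurable_fun setT (@cons_pair T n).
Proof. exact: measurable_cons. Qed.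

HB.instance Definition _ := Measure.copy push_cons
  (measure_function_pushforward__canonical__measure_function_Measure
     (@lebesgue_measure R \x mu)%E measurable_cons_pair).

Let uncons (t : n.+1.-tuple T) : T * n.-tuple T :=
  (thead t, [tuple of behead t]).

Let unconsK : uncons \o @cons_pair T n = id.
Proof. by apply/funext => -[x t]; congr pair; apply/val_inj. Qed.

Let measurable_uncons : measurable_fun setT uncons.
Proof.
apply/measurable_fun_pairP; split; first exact: measurable_tnth.
exact: measurable_behead.
Qed.

Let push_cons_sigma_finite : sigma_finite setT push_cons.
Proof.
have /sigma_finiteP[F [TF ndF Foo]] := sigma_finiteT (@lebesgue_measure R).
have /sigma_finiteP[G [TG ndG Goo]] := sigma_finiteT mu.
exists (fun k => uncons @^-1` (F k `*` G k)).
  rewrite -preimage_bigcup -[LHS](preimage_setT uncons); congr (_ @^-1` _).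
  rewrite -setXTT TF TG predeqE => -[x y]; split.
    move=> [/= [i _ Fx] [j _ Gy]]; exists (maxn i j) => //; split.
    - by move: x Fx; exact/subsetPset/ndF/leq_maxl.
    - by move: y Gy; exact/subsetPset/ndG/leq_maxr.
  by move=> [i _ []/= ? ?]; split; exists i.
move=> k; have [mF Fk] := Foo k; have [mG Gk] := Goo k; split.
  rewrite -[X in measurable X]setTI.
  by apply: measurable_uncons => //; exact: measurableX.
rewrite /push_cons /pushforward -comp_preimage unconsK preimage_id.
by rewrite product_measure1E// lte_mul_pinfty// ge0_fin_numE.
Qed.

HB.instance Definition _ :=
  Measure_isSigmaFinite.Build _ _ _ push_cons push_cons_sigma_finite.

End push_cons.

(* Lebesgue measure on R^n, with points of R^n represented as n-tuples: the
   n-fold product of the library's one-dimensional Lebesgue measure. *)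
Fixpoint lebesgue_tuple (R : realType) (n : nat) :
    {sigma_finite_measure set (n.-tuple (measurableTypeR R)) -> \bar R} :=
  match n with
  | 0 => \d_([tuple] : 0.-tuple (measurableTypeR R))
  | n'.+1 => push_cons (lebesgue_tuple R n')
  end.

Lemma lebesgue_tuple_box (R : realType) (n : nat)
    (A : 'I_n -> set (measurableTypeR R)) :
  (forall i, measurable (A i)) ->
  lebesgue_tuple R n [set t | forall i, A i (tnth t i)] =
  (\prod_(i < n) lebesgue_measure (A i))%E.
Proof.
elim: n A => [|n IH] A mA.
  by rewrite big_ord0 /= diracE mem_set// => -[].
rewrite big_ord_recl /= /push_cons /pushforward.
pose B : set (n.-tuple (measurableTypeR R)) :=
  [set t | forall i, A (lift ord0 i) (tnth t i)].
have BE : B = \bigcap_(i in [set: 'I_n])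
    ((fun t => tnth t i) @^-1` A (lift ord0 i)).
  by apply/seteqP; split=> t /= H i; [move=> _; exact: H|exact: H].
rewrite [X in product_measure1 _ _ X](_ : _ = A ord0 `*` B); last first.
  apply/seteqP; split=> -[x t] /= H.
    split=> [|i]; first exact: (H ord0).
    by have := H (lift ord0 i); rewrite tnthS.
  move=> i; case: (unliftP ord0 i) => [j ->|->]; last exact: H.1.
  by rewrite tnthS; exact: H.2.
rewrite product_measure1E//.
  by rewrite -(IH (fun i => A (lift ord0 i))).
rewrite BE; apply: fin_bigcap_measurable => // i _.
by rewrite -[X in measurable X]setTI; exact: measurable_tnth.
Qed.

Section Games.
Context (R : realType).

(* R^(n x n) is identified with R^(n * n) by listing the n * n entries. *)
Definition mx_of_tuple (n : nat) (t : (n * n).-tuple R) : 'M[R]_n :=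
  vec_mx (\row_k tnth t k).

Definition almost_every_game (n : nat) (P : 'M[R]_n -> 'M[R]_n -> Prop) : Prop :=
  {ae (lebesgue_tuple R (n * n) \x lebesgue_tuple R (n * n))%E,
    forall t, P (mx_of_tuple t.1) (mx_of_tuple t.2)}.

Definition mass_one (n : nat) : set 'cV[R]_n := [set z | \sum_i z i 0 = 1].

Definition simplex (n : nat) : set 'cV[R]_n :=
  [set z | (forall i, 0 <= z i 0) /\ \sum_i z i 0 = 1].

Definition utility (n : nat) (M : 'M[R]_n) (x y : 'cV[R]_n) : R :=
  (x^T *m M *m y) 0 0.

Definition makes_A_indifferent (n : nat) (A : 'M[R]_n) (y : 'cV[R]_n) : Prop :=
  forall x x', simplex x -> simplex x' -> utility A x y = utility A x' y.

Definition makes_B_indifferent (n : nat) (B : 'M[R]_n) (x : 'cV[R]_n) : Prop :=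
  forall y y', simplex y -> simplex y' -> utility B x y = utility B x y'.

(* The entry A i j is the payoff of Player A at the pure profile (i, j);
   likewise for B. *)
Definition nondegenerate_game (n : nat) (A B : 'M[R]_n) : Prop :=
  (forall j, exists! i, forall k, A k j <= A i j) /\
  (forall i, exists! j, forall k, B i k <= B i j).

Definition regionA (n : nat) (A : 'M[R]_n) (i : 'I_n) : set 'cV[R]_n :=
  [set y | simplex y /\ forall k, (A *m y) k 0 <= (A *m y) i 0].

Definition regionB (n : nat) (B : 'M[R]_n) (j : 'I_n) : set 'cV[R]_n :=
  [set x | simplex x /\ forall k, (x^T *m B) 0 k <= (x^T *m B) 0 j].

Definition plane_point (p : R * R) : 'cV[R]_3 :=
  \col_i [:: p.1; p.2; 1 - p.1 - p.2]`_i.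

(* Two-dimensional Lebesgue measure on the plane z_0 + z_1 + z_2 = 1, in the
   coordinates (z_0, z_1); the Euclidean area is Num.sqrt 3 times this one. *)
Definition plane_measure (Z : set 'cV[R]_3) : \bar R :=
  (@lebesgue_measure R \x @lebesgue_measure R)%E (plane_point @^-1` Z).

(* For j != k and n = 3, the last condition concerns only the third index. *)
Definition indiff_lineA (n : nat) (A : 'M[R]_n) (j k : 'I_n) : set 'cV[R]_n :=
  [set y | [/\ simplex y, (A *m y) j 0 = (A *m y) k 0 &
    forall i, i != j -> i != k -> (A *m y) i 0 < (A *m y) j 0]].

Definition indiff_lineB (n : nat) (B : 'M[R]_n) (j k : 'I_n) : set 'cV[R]_n :=
  [set x | [/\ simplex x, (x^T *m B) 0 j = (x^T *m B) 0 k &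
    forall i, i != j -> i != k -> (x^T *m B) 0 i < (x^T *m B) 0 j]].

Definition line (n : nat) (p d : 'cV[R]_n) : set 'cV[R]_n :=
  [set p + t *: d | t in [set: R]].

(* Parallel is meant in the strict sense: coincident lines are excluded. *)
Definition parallel_lines (n : nat) (L L' : set 'cV[R]_n) : Prop :=
  exists p q d, [/\ d != 0, L = line p d, L' = line q d & L `&` L' = set0].

Definition parallel (n : nat) (S S' : set 'cV[R]_n) : Prop :=
  exists L L', [/\ parallel_lines L L', L `<=` @mass_one n, L' `<=` @mass_one n,
    S `<=` L & S' `<=` L'].

(* The indifferent lines of a 3 x 3 game are pairwise parallel, leaving out the
   empty ones; the indices 0, 1, 2 stand for the pure strategies 1, 2, 3. *)
Definition mutually_parallel (l : 'I_3 -> 'I_3 -> set 'cV[R]_3) : Prop :=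
  let par S S' := S !=set0 -> S' !=set0 -> parallel S S' in
  [/\ par (l 0 1) (l 0 2), par (l 0 1) (l 1 2) & par (l 0 2) (l 1 2)].

End Games.

(* Main.v *)
(* A point y of mass one makes Player A indifferent iff A y is a multiple of the
   all-ones vector 1.  If det A != 0 and 1^T adj(A) 1 != 0, the only such point
   is adj(A) 1 / (1^T adj(A) 1).  These conditions say that a polynomial in the
   entries of A, nonzero at the identity matrix, does not vanish, and the zero
   set of a nonzero polynomial is null by induction on the number of variables.
   Transposition handles Player B.

   If no such y exists, the matrix of the linear system for y and the common
   payoff is singular, which yields a direction d != 0 of the plane of mass one
   along which all differences of payoffs are constant.  For 3 x 3 games every
   indifferent line then has direction d, since nondegeneracy prevents the
   equation defining a nonempty one from holding on the whole plane.  Two of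
   these lines do not meet, as a common point would make the player
   indifferent. *)
Require Import Defs.
From mathcomp Require Import all_boot all_order all_algebra.
From mathcomp Require Import all_classical all_reals all_analysis.
From mathcomp Require Import measurable_realfun ring lra.
Local Open Scope classical_set_scope.
Local Open Scope ring_scope.
Set Implicit Arguments.
Unset Strict Implicit.
Unset Printing Implicit Defensive.
Import Order.TTheory GRing.Theory Num.Theory.

(** * Polynomial functions and their zero sets *)

Section PolynomialFunctions.
Variable R : realType.
Local Notation T := (measurableTypeR R).

(** Polynomial functions are given by closure rules rather than as values of formal polynomials in
    [n] variables, so that measurability and the passage to sections are inductions on the rules. *)
Inductive poly_fun (n : nat) : (n.-tuple T -> R) -> Prop :=
| poly_fun_cst c : poly_fun (fun=> c)
| poly_fun_tnth i : poly_fun (fun t => tnth t i)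
| poly_funD f g : poly_fun f -> poly_fun g -> poly_fun (fun t => f t + g t)
| poly_funM f g : poly_fun f -> poly_fun g -> poly_fun (fun t => f t * g t).

Lemma poly_fun_sum n (I : Type) (r : seq I) (P : pred I)
    (F : I -> n.-tuple T -> R) :
  (forall i, poly_fun (F i)) -> poly_fun (fun t => \sum_(i <- r | P i) F i t).
Proof.
move=> FP; elim: r => [|i r IH].
  rewrite (_ : (fun t => _) = fun=> 0); first exact: poly_fun_cst.
  by apply/funext => t; rewrite big_nil.
case Pi: (P i); last first.
  by under [X in poly_fun X]funext => t do rewrite big_cons Pi.
under [X in poly_fun X]funext => t do rewrite big_cons Pi.
exact: poly_funD.
Qed.

Lemma poly_fun_prod n (I : Type) (r : seq I) (P : pred I)
    (F : I -> n.-tuple T -> R) :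
  (forall i, poly_fun (F i)) -> poly_fun (fun t => \prod_(i <- r | P i) F i t).
Proof.
move=> FP; elim: r => [|i r IH].
  rewrite (_ : (fun t => _) = fun=> 1); first exact: poly_fun_cst.
  by apply/funext => t; rewrite big_nil.
case Pi: (P i); last first.
  by under [X in poly_fun X]funext => t do rewrite big_cons Pi.
under [X in poly_fun X]funext => t do rewrite big_cons Pi.
exact: poly_funM.
Qed.

Lemma poly_fun_det n m (M : n.-tuple T -> 'M[R]_m) :
  (forall i j, poly_fun (fun t => M t i j)) -> poly_fun (fun t => \det (M t)).
Proof.
move=> MP; apply: poly_fun_sum => s; apply: poly_funM; first exact: poly_fun_cst.
exact: poly_fun_prod.
Qed.

Lemma poly_fun_adj n m (M : n.-tuple T -> 'M[R]_m) i j :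
  (forall i j, poly_fun (fun t => M t i j)) ->
  poly_fun (fun t => (\adj (M t)) i j).
Proof.
move=> MP; under [X in poly_fun X]funext => t do rewrite mxE.
apply: poly_funM; first exact: poly_fun_cst.
apply: poly_fun_det => k l.
by under [X in poly_fun X]funext => t do rewrite !mxE.
Qed.

Lemma measurable_poly_fun n (f : n.-tuple T -> R) :
  poly_fun f -> measurable_fun setT (f : n.-tuple T -> T).
Proof.
elim=> [c|i|g h _ mg _ mh|g h _ mg _ mh].
- exact: measurable_cst.
- exact: measurable_tnth.
- exact: measurable_funD.
- exact: measurable_funM.
Qed.

Lemma measurable_poly_fun_zeros n (f : n.-tuple T -> R) :
  poly_fun f -> measurable [set t | f t = 0].
Proof.
move=> /measurable_poly_fun mf.
rewrite (_ : [set t | _] = f @^-1` [set 0]) // -[X in measurable X]setTI.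
by apply: mf => //; exact: measurable_set1.
Qed.

Lemma poly_fun_cons n (f : n.+1.-tuple T -> R) x :
  poly_fun f -> poly_fun (fun t : n.-tuple T => f (cons_pair (x, t))).
Proof.
elim=> [c|i|g h _ IHg _ IHh|g h _ IHg _ IHh].
- exact: poly_fun_cst.
- case: (unliftP ord0 i) => [j ->|->].
    under [X in poly_fun X]funext => t do rewrite tnthS.
    exact: poly_fun_tnth.
  by under [X in poly_fun X]funext => t do rewrite tnth0; exact: poly_fun_cst.
- exact: poly_funD.
- exact: poly_funM.
Qed.

Lemma poly_fun_horner n (f : n.+1.-tuple T -> R) (t : n.-tuple T) :
  poly_fun f -> exists p : {poly R}, forall x, f (cons_pair (x, t)) = p.[x].
Proof.
elim=> [c|i|g h _ [p pE] _ [q qE]|g h _ [p pE] _ [q qE]].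
- by exists c%:P => x; rewrite hornerC.
- case: (unliftP ord0 i) => [j ->|->].
    by exists (tnth t j)%:P => x; rewrite hornerC tnthS.
  by exists 'X => x; rewrite hornerX tnth0.
- by exists (p + q) => x; rewrite hornerD pE qE.
- by exists (p * q) => x; rewrite hornerM pE qE.
Qed.

Lemma finite_poly_roots (p : {poly R}) :
  p != 0 -> finite_set [set x | p.[x] = 0].
Proof.
(* An infinite root set would contain [size p] distinct roots, too many for a nonzero [p]. *)
move=> p0; apply: contrapT => /(infinite_set_fset (size p)) [B Bp].
have /(max_poly_roots p0) /(_ (finmap.fset_uniq B)) : all (root p) (finmap.enum_fset B).
  by apply/allP => x /Bp /= px; apply/rootP.
by rewrite ltnNge => /negP pB /pB.
Qed.

(* If f(x0 :: t0) != 0, then f(x :: t0) != 0 for all but finitely many x, so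
   almost every section of the zero set is null by induction. *)
Lemma poly_fun_zeros_null n (f : n.-tuple T -> R) t0 :
  poly_fun f -> f t0 != 0 -> lebesgue_tuple R n [set t | f t = 0] = 0%E.
Proof.
elim: n f t0 => [|n IH] f t0 fP ft0.
  (* In dimension 0 the measure is the Dirac mass at the empty tuple, which is not a zero of [f]. *)
  rewrite /= diracE memNset //= => f0.
  by move/eqP: ft0; apply; rewrite tuple0.
rewrite /= /push_cons /pushforward.
set Z := _ @^-1` _.
have mZ : measurable Z.
  rewrite -[Z]setTI; apply: measurable_cons => //.
  exact: measurable_poly_fun_zeros.
(* The measure of [Z] is the integral of the measures of its sections, so it is enough that almost
   all sections are null. *)
rewrite /product_measure1 (ae_eq_integral (cst 0%E)) //.
- by rewrite integral0.
- exact: measurable_fun_xsection.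
have [p pE] := poly_fun_horner [tuple of behead t0] fP.
have t0E : t0 = cons_pair (thead t0, [tuple of behead t0]).
  by rewrite [LHS]tuple_eta; apply/val_inj.
have p0 : p != 0.
  apply: contraNneq ft0 => p0.
  by rewrite t0E pE p0 horner0.
exists [set x | p.[x] = 0]; split.
- apply: countable_measurable; first exact: measurable_set1.
  exact/finite_set_countable/finite_poly_roots.
- exact/countable_lebesgue_measure0/finite_set_countable/finite_poly_roots.
- move=> x /= /not_implyP [_ H]; apply: contrapT => px; apply: H.
  rewrite /= -(IH (fun t => f (cons_pair (x, t))) [tuple of behead t0]).
  + by congr (lebesgue_tuple R n _); rewrite xsectionE.
  + exact: poly_fun_cons.
  + by rewrite pE; apply/eqP.
Qed.

End PolynomialFunctions.

(** * Indifference points and their uniqueness in almost every game *)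

Section IndifferencePoints.
Variable R : realType.

(** The utility of [x] is the average of the entries of [A *m y] with weights [x]; comparing
    vertices of the simplex shows that indifference makes these entries equal. *)
Lemma makes_A_indifferentP n (A : 'M[R]_n) (y : 'cV[R]_n) :
  makes_A_indifferent A y <-> exists c, A *m y = const_mx c.
Proof.
have utilityE (x : 'cV[R]_n) : utility A x y = \sum_i x i 0 * (A *m y) i 0.
  rewrite /utility -mulmxA mxE.
  by apply: eq_bigr => i _; rewrite [x^T _ _]mxE.
split=> [H|[c Ayc] x x' [_ x1] [_ x'1]]; last first.
  rewrite !utilityE Ayc.
  under eq_bigr do rewrite mxE; under [RHS]eq_bigr do rewrite mxE.
  by rewrite -!mulr_suml x1 x'1.
have vertexE i : \sum_j (delta_mx i 0 : 'cV[R]_n) j 0 * (A *m y) j 0 =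
    (A *m y) i 0.
  rewrite (bigD1 i) //= big1 => [|j ji].
    by rewrite mxE !eqxx mul1r addr0.
  by rewrite mxE (negbTE ji) mul0r.
have vertex_simplex i : simplex (delta_mx i 0 : 'cV[R]_n).
  split=> [j|]; first by rewrite mxE ler0n.
  rewrite (bigD1 i) //= big1 => [|j ji].
    by rewrite mxE !eqxx addr0.
  by rewrite mxE (negbTE ji).
(* Without pure strategies any constant serves; otherwise it is the payoff of the first one. *)
case: n => [|n] in A y H utilityE vertexE vertex_simplex *.
  by exists 0; apply/colP; case.
exists ((A *m y) 0 0); apply/colP => i; rewrite [RHS]mxE -(vertexE i) -(vertexE 0) -!utilityE.
exact: H.
Qed.

(** Reduces Player B to Player A, so that the main arguments are needed for Player A alone. *)
Lemma makes_B_indifferent_tr n (B : 'M[R]_n) (x : 'cV[R]_n) :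
  makes_B_indifferent B x <-> makes_A_indifferent B^T x.
Proof.
have utility_tr y : utility B x y = utility B^T y x.
  by rewrite /utility -[x^T *m B *m y]trmxK mxE !trmx_mul trmxK mulmxA.
by split=> H y y' Sy Sy'; have := H y y' Sy Sy'; rewrite !utility_tr.
Qed.

(** This is 1^T adj(A) 1, the mass of the unnormalised solution adj(A) 1. Unlike the entry sum of
    the inverse, it is polynomial in the entries of [A]. *)
Definition adj_sum n (A : 'M[R]_n) : R := \sum_i \sum_j \adj A i j.

Lemma adj_sum_tr n (A : 'M[R]_n) : adj_sum A^T = adj_sum A.
Proof.
rewrite /adj_sum exchange_big; apply: eq_bigr => i _; apply: eq_bigr => j _.
by rewrite -trmx_adj mxE.
Qed.

Lemma exists_unique_indifferent n (A : 'M[R]_n) :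
  \det A != 0 -> adj_sum A != 0 ->
  exists! y, mass_one y /\ makes_A_indifferent A y.
Proof.
move=> dA sA; have uA : A \in unitmx by rewrite unitmxE unitfE.
pose u : 'cV[R]_n := \adj A *m const_mx 1.
have sumu : \sum_i u i 0 = adj_sum A.
  apply: eq_bigr => i _; rewrite [LHS]mxE.
  by apply: eq_bigr => j _; rewrite [const_mx _ _ _]mxE mulr1.
have Au : A *m u = const_mx (\det A).
  rewrite mulmxA mul_mx_adj mul_scalar_mx.
  by apply/colP => i; rewrite !mxE mulr1.
exists ((adj_sum A)^-1 *: u); split.
  split.
    rewrite /mass_one /=; under eq_bigr do rewrite mxE.
    by rewrite -mulr_sumr sumu mulVf.
  apply/makes_A_indifferentP; exists ((adj_sum A)^-1 * \det A).
  by rewrite -scalemxAr Au; apply/colP => i; rewrite !mxE.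
move=> y [y1 /makes_A_indifferentP [c Ayc]].
(* Invertibility of [A] leaves only multiples of [u]; the mass then fixes the factor. *)
have yE : y = (c / \det A) *: u.
  apply: (can_inj (mulKmx uA)); rewrite Ayc -scalemxAr Au.
  by apply/colP => i; rewrite !mxE divfK.
rewrite yE; congr (_ *: _).
have := y1; rewrite /mass_one /= yE; under eq_bigr do rewrite mxE.
by rewrite -mulr_sumr sumu => /(canRL (mulfK sA)) ->; rewrite mul1r.
Qed.

Lemma poly_fun_mx_of_tuple n (i j : 'I_n) :
  poly_fun (fun t : (n * n).-tuple (measurableTypeR R) => mx_of_tuple t i j).
Proof.
under [X in poly_fun X]funext => t do rewrite !mxE.
exact: poly_fun_tnth.
Qed.

Lemma mx_of_tuple_surj n (A : 'M[R]_n) : exists t, mx_of_tuple t = A.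
Proof.
exists [tuple mxvec A 0 k | k < n * n]; rewrite -[RHS]mxvecK; congr vec_mx.
by apply/rowP => k; rewrite mxE tnth_mktuple.
Qed.

Lemma det_adj_sum_zeros_null n : (0 < n)%N ->
  lebesgue_tuple R (n * n)
    [set t | \det (mx_of_tuple t) * adj_sum (mx_of_tuple t) = 0] = 0%E /\
  measurable [set t : (n * n).-tuple (measurableTypeR R) |
    \det (mx_of_tuple t) * adj_sum (mx_of_tuple t) = 0].
Proof.
move=> n0; have [t1 t1E] := mx_of_tuple_surj (1%:M : 'M[R]_n).
have fP : poly_fun (fun t : (n * n).-tuple (measurableTypeR R) =>
    \det (mx_of_tuple t) * adj_sum (mx_of_tuple t)).
  apply: poly_funM; first exact/poly_fun_det/poly_fun_mx_of_tuple.
  apply: poly_fun_sum => i; apply: poly_fun_sum => j.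
  exact/poly_fun_adj/poly_fun_mx_of_tuple.
split; last exact: measurable_poly_fun_zeros.
apply: (poly_fun_zeros_null (t0 := t1)) => //.
(* At the identity the polynomial takes the value [n], which is nonzero as [n] is positive. *)
rewrite t1E det1 mul1r /adj_sum.
have -> : \adj (1%:M : 'M[R]_n) = 1%:M.
  by rewrite -[LHS]mul1mx mul_mx_adj det1.
under eq_bigr => i _.
  rewrite (bigD1 i) //= big1 => [|j ji]; last by rewrite mxE eq_sym (negbTE ji).
  rewrite mxE eqxx addr0.
  over.
by rewrite sumr_const card_ord pnatr_eq0 -lt0n.
Qed.

Lemma almost_every_game_unique n : (0 < n)%N ->
  almost_every_game (fun A B : 'M[R]_n =>
    exists! p : 'cV[R]_n * 'cV[R]_n,
      [/\ mass_one p.1, mass_one p.2,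
          makes_A_indifferent A p.2 & makes_B_indifferent B p.1]).
Proof.
move=> /det_adj_sum_zeros_null []; set N := [set t | _] => N0 mN.
pose mu := lebesgue_tuple R (n * n).
(* Outside this set both matrices avoid [N]. Each of the two cylinders is null, since 0 times an
   infinite measure is 0. *)
exists (N `*` setT `|` setT `*` N); split.
- by apply: measurableU; apply: measurableX.
- apply: null_set_setU; rewrite /null_set.
  + exact: measurableX.
  + exact: measurableX.
  + rewrite [LHS](product_measure1E mu mu mN measurableT).
    by rewrite [X in (X * _)%E]N0 mul0e.
  + rewrite [LHS](product_measure1E mu mu measurableT mN).
    by rewrite [X in (_ * X)%E]N0 mule0.
move=> [s t] /=; apply: contra_notP => /not_orP[Ns Nt].
have {}Ns : ~ N s by move=> ?; apply: Ns.
have {}Nt : ~ N t by move=> ?; apply: Nt.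
set A := mx_of_tuple s; set B := mx_of_tuple t.
have /norP[dA sA] : ~~ ((\det A == 0) || (adj_sum A == 0)).
  by rewrite -mulf_eq0; apply/eqP.
(* Determinant and [adj_sum] are invariant under transposition, so [t] outside [N] also gives the
   condition for [B^T]. *)
have /norP[dB sB] : ~~ ((\det B^T == 0) || (adj_sum B^T == 0)).
  by rewrite -mulf_eq0 det_tr adj_sum_tr; apply/eqP.
have [y [[y1 Ay] yU]] := exists_unique_indifferent dA sA.
have [x [[x1 /makes_B_indifferent_tr Bx] xU]] := exists_unique_indifferent dB sB.
exists (x, y); split=> // -[x' y'] /= [x'1 y'1 Ay' /makes_B_indifferent_tr Bx'].
by rewrite (xU x') ?(yU y').
Qed.

End IndifferencePoints.

(** * Parallelism of the indifferent lines *)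

Section ParallelIndifferentLines.
Variable R : realType.

Lemma indifferent_direction n (A : 'M[R]_n.+1) :
  ~ (exists y, mass_one y /\ makes_A_indifferent A y) ->
  exists d : 'cV[R]_n.+1,
    [/\ d != 0, \sum_i d i 0 = 0 & exists c, A *m d = const_mx c].
Proof.
move=> noy.
(* [N] sends (v, c) to (A v - c 1, sum of v). If it is invertible, the preimage of (0, 1) is an
   indifference point of mass one. *)
pose N : 'M[R]_(n.+1 + 1) := block_mx A (const_mx (-1)) (const_mx 1) 0.
have NE (v : 'cV[R]_n.+1) (c : 'cV[R]_1) :
    N *m col_mx v c = col_mx (A *m v - const_mx (c 0 0)) (const_mx (\sum_i v i 0)).
  rewrite mul_block_col mul0mx addr0; congr col_mx.
    congr (_ + _); apply/colP => i; rewrite mxE big_ord1 !mxE.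
    by rewrite mulN1r.
  apply/colP => i; rewrite [LHS]mxE [RHS]mxE.
  by apply: eq_bigr => k _; rewrite [const_mx _ _ _]mxE mul1r.
have [uN|] := boolP (N \in unitmx).
  case: noy; pose z : 'cV[R]_(n.+1 + 1) := invmx N *m col_mx 0 (const_mx 1).
  have : N *m z = col_mx 0 (const_mx 1) by exact: mulKVmx.
  rewrite -[z]vsubmxK NE => /eq_col_mx[zA z1]; exists (usubmx z); split.
    by have /colP/(_ 0) := z1; rewrite !mxE.
  by apply/makes_A_indifferentP; exists (dsubmx z 0 0); apply/subr0_eq.
(* [det0P] yields a left kernel vector, hence the passage to the transpose. *)
rewrite -unitmx_tr unitmxE unitfE negbK => /det0P[v v0 vN].
have {vN} : N *m v^T = 0 by rewrite -[LHS]trmxK trmx_mul trmxK vN trmx0.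
rewrite -[v^T]vsubmxK NE -[RHS]col_mx0 => /eq_col_mx[/subr0_eq vA /colP/(_ 0) v1].
exists (usubmx v^T); split; [|by move: v1; rewrite !mxE|by eexists; exact: vA].
(* If the direction were 0, then c 1 = 0; a first coordinate exists in dimension [n.+1], so c = 0
   and the whole kernel vector vanishes. *)
apply: contraNneq v0 => u0; rewrite -[v]trmxK -[v^T]vsubmxK u0.
have d0 : dsubmx v^T = 0.
  apply/colP => i; rewrite ord1 [RHS]mxE.
  by move: vA; rewrite u0 mulmx0 => /colP/(_ 0); rewrite [LHS]mxE [RHS]mxE => <-.
by rewrite d0 col_mx0 trmx0.
Qed.

Lemma ord3P (i : 'I_3) : [\/ i = 0, i = 1 | i = 2].
Proof.
case: i => [[|[|[|//]]] i3].
- by apply: Or31; apply/val_inj.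
- by apply: Or32; apply/val_inj.
- by apply: Or33; apply/val_inj.
Qed.

Lemma sum3E (F : 'I_3 -> R) : \sum_i F i = F 0 + F 1 + F 2.
Proof.
rewrite !big_ord_recl big_ord0 addr0 addrA.
by congr (_ + F _ + F _); apply/val_inj.
Qed.

Lemma third_index (j k : 'I_3) : j != k ->
  exists m, [/\ m != j, m != k & forall i, i != j -> i != k -> i = m].
Proof.
(* The three indices sum to 0 modulo 3. *)
move=> jk; exists (- (j + k)).
by case: (ord3P j) jk => ->; case: (ord3P k) => -> // _; split=> // i;
  case: (ord3P i) => -> // _ _; apply/val_inj.
Qed.

(* Were two rows equal, neither would be a best response to any pure strategy,
   so the third row would dominate both. *)
Lemma indiff_lineA_rows_neq (A : 'M[R]_3) j k p :
  (forall l, exists! i, forall i', A i' l <= A i l) -> j != k ->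
  indiff_lineA A j k p -> exists l, A j l != A k l.
Proof.
move=> ndA jk [[p_ge0 _] _ pm]; apply: contrapT => /forallNP eqA.
have {}eqA l : A j l = A k l by apply/eqP/negPn/negP; exact: eqA.
have [m [mj mk mE]] := third_index jk.
have Ajm l : A j l <= A m l.
  have [b [bbest bU]] := ndA l.
  rewrite -(mE b) //; apply/eqP => bE.
  - by move/eqP: jk; apply; rewrite -(bU k) // => i; rewrite -eqA -bE.
  - by move/eqP: jk; apply; rewrite -(bU j) // => i; rewrite eqA -bE.
(* Averaging [Ajm] with the nonnegative weights [p] contradicts the strict inequality at [p]. *)
have := pm m mj mk; rewrite ltNge => /negP; apply.
by rewrite !mxE; apply: ler_sum => l _; rewrite ler_wpM2r.
Qed.

(** Both [d] and [q - p] have coordinate sum 0 and give rows [j] and [k] equal payoffs. Since these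
    rows differ but agree in payoff at [p], this condition is nontrivial on the vectors of sum 0, so
    [q - p] is a multiple of [d]. *)
Lemma indiff_lineA_sub_line (A : 'M[R]_3) (d : 'cV[R]_3) j k p :
  (forall l, exists! i, forall i', A i' l <= A i l) -> j != k ->
  d != 0 -> \sum_i d i 0 = 0 -> (A *m d) j 0 = (A *m d) k 0 ->
  indiff_lineA A j k p -> indiff_lineA A j k `<=` line p d.
Proof.
move=> ndA jk d_neq0 d0 Ad pL q [[_ q1] Aq _].
have [l rl] := indiff_lineA_rows_neq ndA jk pL.
have [[_ p1] Ap _] := pL.
move: Ad Ap Aq d0 p1 q1; rewrite !mxE !sum3E => Ad Ap Aq d0 p1 q1.
(* The first two coordinates of [d] and [q - p] are proportional; [a] and [b] are the coefficients
   of the payoff difference once the third coordinate is eliminated. *)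
have dv : d 0 0 * (q 1 0 - p 1 0) = d 1 0 * (q 0 0 - p 0 0).
  set a := (A j 0 - A k 0) - (A j 2 - A k 2).
  set b := (A j 1 - A k 1) - (A j 2 - A k 2).
  have abd : a * d 0 0 + b * d 1 0 = 0.
    have d2 : d 2 0 = - d 0 0 - d 1 0 by lra.
    by move: Ad; rewrite d2 /a /b; lra.
  have abv : a * (q 0 0 - p 0 0) + b * (q 1 0 - p 1 0) = 0.
    have q2 : q 2 0 = 1 - q 0 0 - q 1 0 by lra.
    have p2 : p 2 0 = 1 - p 0 0 - p 1 0 by lra.
    by move: Ap Aq; rewrite q2 p2 /a /b; lra.
  have [a0|a_neq0] := eqVneq a 0; last first.
    apply: (mulfI a_neq0); rewrite [LHS]mulrA [RHS]mulrCA.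
    by rewrite (canRL (addrK _) abd) (canRL (addrK _) abv); ring.
  have [b0|b_neq0] := eqVneq b 0; last first.
    apply: (mulfI b_neq0); rewrite [LHS]mulrCA [RHS]mulrA.
    by rewrite -(addr0_eq abd) -(addr0_eq abv); ring.
  (* With [a] and [b] both 0, the difference of the two rows is constant. It equals the payoff
     difference at [p], hence 0, against [rl]. *)
  case/eqP: rl.
  have r0 : A j 0 - A k 0 = A j 2 - A k 2 by move: a0; rewrite /a; lra.
  have r1 : A j 1 - A k 1 = A j 2 - A k 2 by move: b0; rewrite /b; lra.
  have r2 : A j 2 - A k 2 = 0.
    rewrite -[LHS]mulr1 -p1 !mulrDr -{1}r0 -{1}r1; lra.
  by case: (ord3P l) => ->; lra.
(* The parameter on the line is read off from a nonzero coordinate among the first two of [d]; if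
   both vanish, so does the third. *)
have [x0|x_neq0] := eqVneq (d 0 0) 0; last first.
  exists ((q 0 0 - p 0 0) / d 0 0) => //.
  have dE : (q 0 0 - p 0 0) / d 0 0 * d 1 0 = q 1 0 - p 1 0.
    by apply: (mulfI x_neq0); rewrite dv; field.
  apply/colP => i; rewrite !mxE.
  have d2 : d 2 0 = - d 0 0 - d 1 0 by lra.
  by case: (ord3P i) => ->; rewrite ?d2 ?mulrBr ?mulrN ?dE ?divfK //; lra.
have [y0|y_neq0] := eqVneq (d 1 0) 0; last first.
  exists ((q 1 0 - p 1 0) / d 1 0) => //.
  have dE : (q 1 0 - p 1 0) / d 1 0 * d 0 0 = q 0 0 - p 0 0.
    by apply: (mulfI y_neq0); rewrite -dv; field.
  apply/colP => i; rewrite !mxE.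
  have d2 : d 2 0 = - d 0 0 - d 1 0 by lra.
  by case: (ord3P i) => ->; rewrite ?d2 ?mulrBr ?mulrN ?dE ?divfK //; lra.
case/eqP: d_neq0; apply/colP => i; rewrite mxE.
by case: (ord3P i) => ->; lra.
Qed.

Lemma line_mass_one n (p d : 'cV[R]_n) :
  mass_one p -> \sum_i d i 0 = 0 -> line p d `<=` @mass_one R n.
Proof.
move=> p1 d0 _ [t _ <-]; rewrite /mass_one /=.
under eq_bigr do rewrite mxE [X in _ + X]mxE.
by rewrite big_split /= -mulr_sumr d0 mulr0 addr0.
Qed.

Lemma line_payoffs_eq n (A : 'M[R]_n) (p d : 'cV[R]_n) j k :
  (A *m p) j 0 = (A *m p) k 0 -> (A *m d) j 0 = (A *m d) k 0 ->
  forall z, line p d z -> (A *m z) j 0 = (A *m z) k 0.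
Proof.
move=> Ap Ad _ [t _ <-]; rewrite mulmxDr -scalemxAr [LHS]mxE [RHS]mxE Ap.
by congr (_ + _); rewrite [LHS]mxE [RHS]mxE Ad.
Qed.

(** The direction [d] does not depend on the pair of rows, so it serves both lines. The condition on
    [z] says that the two index pairs differ, in the form that turns a common point into an
    indifference point. *)
Lemma indiff_linesA_parallel (A : 'M[R]_3) j k j' k' :
  (forall l, exists! i, forall i', A i' l <= A i l) ->
  ~ (exists y, mass_one y /\ makes_A_indifferent A y) ->
  j != k -> j' != k' ->
  (forall z : 'cV[R]_3, z j 0 = z k 0 -> z j' 0 = z k' 0 ->
    exists c, z = const_mx c) ->
  indiff_lineA A j k !=set0 -> indiff_lineA A j' k' !=set0 ->
  parallel (indiff_lineA A j k) (indiff_lineA A j' k').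
Proof.
move=> ndA noy jk j'k' jkP [p pL] [q qL].
have [d [d_neq0 d0 [c Ad]]] := indifferent_direction noy.
have AdE i i' : (A *m d) i 0 = (A *m d) i' 0 by rewrite Ad !mxE.
have [[_ p1] Ap _] := pL; have [[_ q1] Aq _] := qL.
exists (line p d), (line q d); split.
- exists p, q, d; split=> //; rewrite -subset0 => z [zp zq].
  case: noy; exists z; split; first exact: line_mass_one zp.
  apply/makes_A_indifferentP/jkP.
  + exact: line_payoffs_eq zp.
  + exact: line_payoffs_eq zq.
- exact: line_mass_one.
- exact: line_mass_one.
- exact: indiff_lineA_sub_line.
- exact: indiff_lineA_sub_line.
Qed.

Lemma indiff_linesA_mutually_parallel (A : 'M[R]_3) :
  (forall l, exists! i, forall i', A i' l <= A i l) ->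
  ~ (exists y, mass_one y /\ makes_A_indifferent A y) ->
  mutually_parallel (indiff_lineA A).
Proof.
by move=> ndA noy; split; apply: indiff_linesA_parallel => // z e e';
  exists (z 0 0); apply/colP => i; rewrite mxE; case: (ord3P i) => ->; congruence.
Qed.

Lemma indiff_lineB_tr n (B : 'M[R]_n) : indiff_lineB B = indiff_lineA B^T.
Proof.
apply/funext => j; apply/funext => k; apply/funext => x.
have E i : (x^T *m B) 0 i = (B^T *m x) i 0.
  by rewrite -[x^T *m B]trmxK trmx_mul trmxK [LHS]mxE.
apply/propext; split=> -[Sx xjk xi]; split=> // [|i ij ik].
- by rewrite -!E.
- by rewrite -!E; exact: xi.
- by rewrite !E.
- by rewrite !E; exact: xi.
Qed.

End ParallelIndifferentLines.

Theorem lemma3p1 (R : realType) :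
  (forall n : nat, (0 < n)%N ->
    almost_every_game (fun A B : 'M[R]_n =>
      exists! p : 'cV[R]_n * 'cV[R]_n,
        [/\ mass_one p.1, mass_one p.2,
            makes_A_indifferent A p.2 & makes_B_indifferent B p.1])) /\
  (forall A B : 'M[R]_3,
    nondegenerate_game A B ->
    (forall i, (0 < plane_measure (regionA A i))%E) ->
    (forall j, (0 < plane_measure (regionB B j))%E) ->
    (~ (exists y : 'cV[R]_3, mass_one y /\ makes_A_indifferent A y) ->
       mutually_parallel (indiff_lineA A)) /\
    (~ (exists x : 'cV[R]_3, mass_one x /\ makes_B_indifferent B x) ->
       mutually_parallel (indiff_lineB B))).
Proof.
split=> [n|A B [ndA ndB] _ _]; first exact: almost_every_game_unique.
split=> [|nox]; first exact: indiff_linesA_mutually_parallel.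
rewrite indiff_lineB_tr; apply: indiff_linesA_mutually_parallel.
  (* Unique best responses along the rows of [B] are those along the columns of [B^T]. *)
  move=> i; have [j [jbest jU]] := ndB i; exists j; split=> [k|k kbest].
    by rewrite !mxE.
  by apply: jU => l; have := kbest l; rewrite !mxE.
by move=> [x [x1 /makes_B_indifferent_tr Bx]]; apply: nox; exists x.
Qed.
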